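(* Let $\Omega$ be a perfectly normal topological space, let $\alpha$ be an ordinal with $0<\alpha<\omega_1$, and let $A\subset\Omega$ be a non-empty Borel subset of multiplicative class $\alpha$. Every function $f\in\mathscr{B}_\alpha(A)$ has an extension $\overline{f}\in\mathscr{B}_\alpha(\Omega)$ such that $\|f\|_\infty=\|\overline{f}\|_\infty$. More exactly, if $\sup_{x\in A}|f(x)|=c<\infty$, then there exists a sequence $(H_n)_{n=0}^\infty$ of Borel ambiguous class $\alpha$ subsets of $\Omega$ such that the function $$\overline{f}(x):=c\cdot\sum_{n=0}^\infty\left(\frac{2}{3}\right)^{n+1}\left(\frac{1}{2}-\chi_{H_n}(x)\right)$$ extends $f$ with $\sup_{x\in\Omega}|\overline{f}(x)|=c$.
   Context: Baire classes: for a topological space $X$, $\mathscr{B}_0(X)$ is the space of continuous functions $X\to\mathbb{R}$, and for $0<\alpha<\omega_1$, $\mathscr{B}_\alpha(X)$ is the space of pointwise limits of sequences in $\bigcup_{\xi<\alpha}\mathscr{B}_\xi(X)$. The subset $A\subset\Omega$ carries the subspace topology. $\|\cdot\|_\infty$ is the supremum norm, taken over the domain of the function. $\chi_H$ is the characteristic function of $H\subset\Omega$. Borel classes: $\Pi^0_1(\Omega)$ is the family of closed subsets of $\Omega$ and $\Sigma^0_1(\Omega)$ the family of open subsets of $\Omega$. For $0<\alpha<\omega_1$, $\Pi^0_\alpha(\Omega)$ is the multiplicative class $\alpha$ and $\Sigma^0_\alpha(\Omega)$ the additive class $\alpha$ of Borel subsets of $\Omega$: for $1<\alpha<\omega_1$,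 $\Sigma^0_\alpha(\Omega)$ consists of countable unions of members of $\bigcup_{\gamma<\alpha}\Pi^0_\gamma(\Omega)$, and $\Pi^0_\alpha(\Omega)$ consists of countable intersections of members of $\bigcup_{\gamma<\alpha}\Sigma^0_\gamma(\Omega)$. The family of Borel subsets of ambiguous class $\alpha$ is $\Delta^0_\alpha(\Omega)=\Pi^0_\alpha(\Omega)\cap\Sigma^0_\alpha(\Omega)$.
   Formalization: The Borel classes of A and of the H_n are taken at index α+1 (closed sets = class 1): A is in Π_{α+1} and the H_n are in Δ_{α+1}. With index α the H_n would be clopen for α = 1, and the claim fails for f = sin on Ω = A = ℝ. *)

(* Defs.v *)
From HB Require Import structures.
From mathcomp Require Import all_boot all_order all_algebra.
From mathcomp Require Import all_classical all_reals all_analysis.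
From mathcomp Require Export borel_hierarchy.

Set Implicit Arguments.
Unset Strict Implicit.
Unset Printing Implicit Defensive.

Import Order.TTheory GRing.Theory Num.Theory.
Import numFieldNormedType.Exports.

Local Open Scope classical_set_scope.
Local Open Scope ring_scope.

(* No separation of points (T1) is included; neither is it in [normal_space]. *)
Definition perfectly_normal_space (T : topologicalType) : Prop :=
  normal_space T /\ forall C : set T, closed C -> Gdelta C.

Section Hierarchies.

(* Ordinals are the elements of a well-ordered type O, with zero \bot: an
   element a stands for the order type of [set b | b < a].  Every ordinal is
   obtained in this way from some O, and all the classes below depend only on
   the initial segment determined by their index. *)
Context {d : Order.disp_t} {O : bOrderType d}.

Definition well_ordered : Prop := well_founded (fun a b : O => (a < b)%O).

Definition is_succ (a s : O) : Prop := forall b : O, (b < s)%O = (b <= a)%O.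

Definition is_one (a : O) : Prop := is_succ \bot%O a.

(* The limit step forces \bot < a. *)
Inductive baire_class (R : realType) (X : topologicalType) :
    O -> (X -> R) -> Prop :=
| baire_continuous (f : X -> R) : continuous f -> baire_class \bot%O f
| baire_limit (a : O) (f : X -> R) (b : nat -> O) (u : nat -> X -> R) :
    (forall n, (b n < a)%O) ->
    (forall n, baire_class (b n) (u n)) ->
    (forall x, u n x @[n --> \oo] --> f x) ->
    baire_class a f.

(* There is no class of index \bot, so that the second constructors only
   produce sets whose index a is greater than one. *)
Inductive sigma0 (X : topologicalType) : O -> set X -> Prop :=
| sigma0_open (a : O) (U : set X) : is_one a -> open U -> sigma0 a U
| sigma0_bigcup (a : O) (b : nat -> O) (F : nat -> set X) :
    (forall n, (b n < a)%O) ->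
    (forall n, pi0 (b n) (F n)) ->
    sigma0 a (\bigcup_n F n)
with pi0 (X : topologicalType) : O -> set X -> Prop :=
| pi0_closed (a : O) (C : set X) : is_one a -> closed C -> pi0 a C
| pi0_bigcap (a : O) (b : nat -> O) (F : nat -> set X) :
    (forall n, (b n < a)%O) ->
    (forall n, sigma0 (b n) (F n)) ->
    pi0 a (\bigcap_n F n).

(* Closed sets have index one here, whereas continuous functions have Baire
   index \bot: preimages of closed sets under functions of class B_a lie in
   pi0 at the successor of a, not in pi0 at a.  So the Borel classes that go
   with B_a are taken at the successor of a.  For finite a these are the
   multiplicative, additive and ambiguous classes a in the numbering that
   starts with closed and open sets as class zero.  With index a, only clopen
   sets would go with B_1. *)
Definition delta0 (X : topologicalType) (a : O) (H : set X) : Prop :=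
  pi0 a H /\ sigma0 a H.

End Hierarchies.

Arguments well_ordered {d} O.

Definition sup_norm (R : realType) (X : Type) (f : X -> R) : \bar R :=
  ereal_sup (range (fun x => (`|f x|)%:E)).

Definition geometric_step_sum (R : realType) (X : Type) (c : R)
    (H : nat -> set X) (x : X) : R :=
  c * limn (series (fun n => (2 / 3 : R) ^+ n.+1 * (1 / 2 - \1_(H n) x))).

(* Main.v *)
(**
As in Tietze's theorem, the series is built by successive residuals: if [f] is
bounded by [M] on [A], the sets [f <= - M / 3] and [M / 3 <= f] are traces of
disjoint sets of multiplicative class [alpha1], so a set [H] of ambiguous class
separates them, and [f - (2 / 3) M (1 / 2 - \1_H)] is bounded by [(2 / 3) M].
Iterating gives the expansion.  It is of class [alpha] because a uniformly
summable series of such functions is, and because [\1_H] is: if [H] and its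
complement are the unions of sets [F n] and [G n] of multiplicative class
[alpha], whose indicators are of class [alpha], and [p], [r] are the sums of
[2^-n \1_(F n)] and [2^-n \1_(G n)], then [\1_H = p / (p + r)].

If [f] is unbounded, extend [f / (1 + |f|)] to a function [h] bounded by [1],
kill [h] on a set of ambiguous class which contains the set [|h| = 1] and misses
[A], and apply [y |-> y / (1 - |y|)].
*)

Require Import Defs.
From HB Require Import structures.
From mathcomp Require Import all_boot all_order all_algebra.
From mathcomp Require Import all_classical all_reals all_analysis.
From mathcomp Require Import lra ring.

Set Implicit Arguments.
Unset Strict Implicit.
Unset Printing Implicit Defensive.

Import Order.TTheory GRing.Theory Num.Theory.
Import numFieldNormedType.Exports.

Local Open Scope classical_set_scope.
Local Open Scope ring_scope.

(** * Borel classes *)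

Section BorelClasses.
Context {d : Order.disp_t} {O : bOrderType d} {T : topologicalType}.
Hypothesis wo : well_ordered O.
Hypothesis pnT : perfectly_normal_space T.
Implicit Types (a b s : O) (F G : set T).

Lemma is_oneP a b : is_one a -> (b < a)%O -> b = \bot%O.
Proof. by move=> a1; rewrite a1 lex0 => /eqP. Qed.

(** Well-foundedness gives a least index above [\bot]. Open and closed sets enter the classes only
    at that index, so it has to be found inside [O]. *)
Lemma exists_is_one a : (\bot < a)%O -> exists2 o : O, is_one o & (o <= a)%O.
Proof.
elim/(well_founded_ind wo): a => a IH a0.
have [[b [b0 ba]] | min_a] := pselect (exists b : O, (\bot < b)%O /\ (b < a)%O).
  by have [c c1 cb] := IH b ba b0; exists c => //; exact: le_trans cb (ltW ba).
exists a => // b; rewrite lex0; case: eqVneq => [->//|b0].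
by apply/negP => ba; apply: min_a; exists b; rewrite lt0x.
Qed.

Lemma sigma0_inv a F : sigma0 a F -> (is_one a /\ open F) \/
  exists b : nat -> O, exists G : nat -> set T,
    [/\ forall n, (b n < a)%O, forall n, pi0 (b n) (G n) & F = \bigcup_n G n].
Proof. by case=> [{}a U|{}a b G]; [left|right; exists b, G]. Qed.

Lemma pi0_inv a F : pi0 a F -> (is_one a /\ closed F) \/
  exists b : nat -> O, exists G : nat -> set T,
    [/\ forall n, (b n < a)%O, forall n, sigma0 (b n) (G n)
      & F = \bigcap_n G n].
Proof. by case=> [{}a U|{}a b G]; [left|right; exists b, G]. Qed.

(** Each half at [a] uses the other half at smaller indices, so both are proved in one well-founded
    induction. *)
Lemma sigma0_pi0_setC a : (forall F, sigma0 a F -> pi0 a (~` F)) /\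
  (forall F, pi0 a F -> sigma0 a (~` F)).
Proof.
elim/(well_founded_ind wo): a => a IH; split=> F.
  move=> /sigma0_inv[[a1 oF]|[b [G [ba bG ->]]]].
    by apply: pi0_closed => //; exact: open_closedC.
  by rewrite setC_bigcup; apply: pi0_bigcap (ba) _ => n; exact: (IH _ (ba n)).2.
move=> /pi0_inv[[a1 cF]|[b [G [ba bG ->]]]].
  by apply: sigma0_open => //; exact: closed_openC.
by rewrite setC_bigcap; apply: sigma0_bigcup (ba) _ => n; exact: (IH _ (ba n)).1.
Qed.

Lemma pi0_setC a F : sigma0 a F -> pi0 a (~` F).
Proof. exact: (sigma0_pi0_setC a).1. Qed.

Lemma sigma0_setC a F : pi0 a F -> sigma0 a (~` F).
Proof. exact: (sigma0_pi0_setC a).2. Qed.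

Lemma pi0_gt0 a F : pi0 a F -> (\bot < a)%O.
Proof.
case/pi0_inv => [[a1 _]|[b [_ [ba _ _]]]]; first by rewrite a1.
exact: le_lt_trans (le0x _) (ba 0).
Qed.

(** Above index one, perfect normality writes a closed set as a countable intersection of open sets,
    which have index one. This is the base case of [pi0_le]. *)
Lemma closed_pi0 a F : (\bot < a)%O -> closed F -> pi0 a F.
Proof.
move=> /exists_is_one[c c1]; rewrite le_eqVlt => /orP[/eqP <-|ca] cF.
  exact: pi0_closed.
have [U oU ->] := pnT.2 _ cF.
by apply: (@pi0_bigcap _ _ _ _ (fun=> c)) => // n; exact: sigma0_open.
Qed.

Lemma pi0_le a b F : (b <= a)%O -> pi0 b F -> pi0 a F.
Proof.
move=> ba bF; case/pi0_inv: (bF) => [[_ cF]|[c [G [cb cG ->]]]].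
  by apply: closed_pi0 => //; exact: lt_le_trans (pi0_gt0 bF) ba.
by apply: pi0_bigcap cG => n; exact: lt_le_trans (cb n) ba.
Qed.

Lemma pi0_sigma0 a b F : (b < a)%O -> pi0 b F -> sigma0 a F.
Proof.
move=> ba bF; rewrite -(bigcup_const F (ex_intro _ 0 I : [set: nat] !=set0)).
exact: (@sigma0_bigcup _ _ _ _ (fun=> b)).
Qed.

Lemma pi0_delta0 a b F : (b < a)%O -> pi0 b F -> delta0 a F.
Proof.
by move=> ba bF; split; [exact: pi0_le (ltW ba) bF|exact: pi0_sigma0 bF].
Qed.

Lemma delta0_setC a F : delta0 a F -> delta0 a (~` F).
Proof. by move=> [pF sF]; split; [exact: pi0_setC|exact: sigma0_setC]. Qed.

Lemma sigma0_one a F : is_one a -> sigma0 a F -> open F.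
Proof.
move=> a1 /sigma0_inv[[]//|[b [G [ba bG _]]]].
by have := pi0_gt0 (bG 0); rewrite (is_oneP a1 (ba 0)) ltxx.
Qed.

Lemma sigma0_bigcupP a F : ~ is_one a -> sigma0 a F ->
  exists G : nat -> set T,
    (forall n, exists2 b, (b < a)%O & pi0 b (G n)) /\ F = \bigcup_n G n.
Proof.
move=> a1 /sigma0_inv[[]//|[b [G [ba bG ->]]]].
by exists G; split => // n; exists (b n).
Qed.

Lemma sigma0_bigcup_below a (G : nat -> set T) :
  (forall n, exists2 b, (b < a)%O & pi0 b (G n)) -> sigma0 a (\bigcup_n G n).
Proof.
move=> bG.
have /choice[b {}bG] n : exists b, (b < a)%O /\ pi0 b (G n).
  by have [b] := bG n; exists b.
by apply: (@sigma0_bigcup _ _ _ _ b) => n; case: (bG n).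
Qed.

Lemma sigma0_bigcup_countable a (F : nat -> set T) :
  (forall n, sigma0 a (F n)) -> sigma0 a (\bigcup_n F n).
Proof.
move=> sF; have [a1|a1] := pselect (is_one a).
  apply: sigma0_open => //; apply: bigcup_open => n _.
  exact: sigma0_one (sF n).
have /choice[G FG] n := sigma0_bigcupP a1 (sF n).
(* A number that codes no pair is sent to [G 0 0], which already occurs in the union. *)
pose G' m := if unpickle m is Some (n, k) then G n k else G 0 0.
have -> : \bigcup_n F n = \bigcup_n G' n.
  apply/seteqP; split=> x [n _].
    rewrite (FG n).2 => -[k _ Gx]; exists (pickle (n, k)) => //.
    by rewrite /G' pickleK.
  rewrite /G'; case: unpickle => [[i k]|] Gx.
    by exists i => //; rewrite (FG i).2; exists k.
  by exists 0 => //; rewrite (FG 0).2; exists 0.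
apply: sigma0_bigcup_below => n.
by rewrite /G'; case: unpickle => [[i k]|]; exact: (FG _).1.
Qed.

Lemma pi0_bigcap_countable a (F : nat -> set T) :
  (forall n, pi0 a (F n)) -> pi0 a (\bigcap_n F n).
Proof.
move=> pF; rewrite -[X in pi0 _ X]setCK setC_bigcap; apply: pi0_setC.
by apply: sigma0_bigcup_countable => n; exact: sigma0_setC.
Qed.

Lemma pi0_setI a F G : pi0 a F -> pi0 a G -> pi0 a (F `&` G).
Proof.
(* [bigcap2] continues the pair with the whole space, which is closed. *)
by move=> pF pG; rewrite -bigcap2E; apply: pi0_bigcap_countable => -[|[|n]];
  rewrite /bigcap2//=; exact: closed_pi0 (pi0_gt0 pF) closedT.
Qed.

Lemma sigma0_setI a F G : sigma0 a F -> sigma0 a G -> sigma0 a (F `&` G).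
Proof.
move=> sF sG; have [a1|a1] := pselect (is_one a).
  apply: sigma0_open => //.
  by apply: openI; [exact: sigma0_one sF|exact: sigma0_one sG].
have [F' [bF ->]] := sigma0_bigcupP a1 sF.
have [G' [bG ->]] := sigma0_bigcupP a1 sG.
rewrite setI_bigcupl; apply: sigma0_bigcup_countable => n.
rewrite setI_bigcupr; apply: sigma0_bigcup_countable => k.
have [b ba bFn] := bF n; have [c ca cGk] := bG k.
apply: (@pi0_sigma0 a (Order.max b c)); first by rewrite gt_max ba.
by apply: pi0_setI; [apply: pi0_le bFn|apply: pi0_le cGk]; rewrite le_max lexx ?orbT.
Qed.

Lemma sigma0_bigcap_lt a (F : nat -> set T) n : (\bot < a)%O ->
  (forall i, sigma0 a (F i)) -> sigma0 a (\bigcap_(i < n) F i).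
Proof.
move=> a0 sF; rewrite bigcap_mkord; apply: big_ind => //; last exact: sigma0_setI.
by rewrite -setC0; apply/sigma0_setC/closed_pi0 => //; exact: closed0.
Qed.

(** The complements of [P] and [Q] are of additive class [s] and cover the space. As [s] is not one,
    they are unions of sets [A n] and [B n] of ambiguous class, and comparing first occurrences
    shrinks them to a partition into two additive sets, each therefore ambiguous. *)
Lemma pi0_separation a s (P Q : set T) : (\bot < a)%O -> (a < s)%O ->
  pi0 s P -> pi0 s Q -> P `&` Q = set0 ->
  exists D : set T, [/\ delta0 s D, P `<=` D & Q `<=` ~` D].
Proof.
move=> a0 as_ pP pQ PQ0.
have s1 : ~ is_one s by move=> s1; move: a0; rewrite (is_oneP s1 as_) ltxx.
have s0 : (\bot < s)%O := pi0_gt0 pP.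
have [A [bA /seteqP[PA AP]]] := sigma0_bigcupP s1 (sigma0_setC pP).
have [B [bB /seteqP[QB BQ]]] := sigma0_bigcupP s1 (sigma0_setC pQ).
have dA n : delta0 s (A n) by have [b bs] := bA n; exact: pi0_delta0.
have dB n : delta0 s (B n) by have [b bs] := bB n; exact: pi0_delta0.
(* [D] holds the points which some [B n] catches before any [A n] does, with
   ties going to [E]. *)
pose D := \bigcup_n (B n `&` \bigcap_(j < n.+1) ~` A j).
pose E := \bigcup_n (A n `&` \bigcap_(j < n) ~` B j).
have sD : sigma0 s D.
  apply: sigma0_bigcup_countable => n; apply: sigma0_setI; first exact: (dB n).2.
  by apply: sigma0_bigcap_lt => // i; exact: (delta0_setC (dA i)).2.
have sE : sigma0 s E.
  apply: sigma0_bigcup_countable => n; apply: sigma0_setI; first exact: (dA n).2.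
  by apply: sigma0_bigcap_lt => // i; exact: (delta0_setC (dB i)).2.
have DE : D = ~` E.
  apply/seteqP; split=> x.
    move=> [n _ [Bx Ax]] [m _ [Ax' Bx']].
    have [mn|nm] := leqP m n; first exact: Ax Ax'.
    exact: Bx' nm Bx.
  move=> Ex.
  (* The least [n] for which [A n] or [B n] contains [x] decides: [A n] would put [x] in [E], so it
     is [B n], and no [A j] with [j <= n] contains [x]. *)
  have /ex_minnP[n] : exists n, `[< (A n `|` B n) x >].
    have [Px|/PA[n _ Ax]] := pselect (P x); last by exists n; apply/asboolP; left.
    have /QB[n _ Bx] : (~` Q) x by move=> Qx; rewrite -[False]/(@set0 T x) -PQ0.
    by exists n; apply/asboolP; right.
  move=> /asboolP ABx minn.
  have ltn_notAB j : (j < n)%N -> ~ A j x /\ ~ B j x.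
    move=> jn; apply/not_orP => ABj; have /minn := asboolT ABj.
    by rewrite leqNgt jn.
  have nAx : ~ A n x.
    by move=> Ax; apply: Ex; exists n => //; split => // j /= /ltn_notAB[].
  case: ABx => // Bx; exists n => //; split => // j /=.
  by rewrite ltnS leq_eqVlt => /orP[/eqP->|/ltn_notAB[]].
exists D; split; first by split => //; rewrite DE; exact: pi0_setC.
  by rewrite DE => x Px [n _ [Ax _]]; apply: (AP x) => //; exists n.
by move=> x Qx [n _ [Bx _]]; apply: (BQ x) => //; exists n.
Qed.

End BorelClasses.

(** * Geometrically weighted sums *)

Section GeometricSums.
Context {R : realType}.
Variable q : R.
Hypotheses (q0 : 0 <= q) (q1 : q < 1).
Implicit Types (v : nat -> R) (M : R).

Let q1' : 0 < 1 - q. Proof. by rewrite subr_gt0. Qed.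

(** Multiplication by [1 - q] telescopes the sum of the powers. The bound depends on neither [n] nor
    [v]: it serves for the whole sum at [m = 0] and as a uniform tail estimate. *)
Lemma geometric_tail_norm_le v M m n : (m <= n)%N ->
  (forall i, `|v i| <= M) ->
  `|\sum_(m <= i < n) q ^+ i.+1 * v i| <= M * q ^+ m.+1 / (1 - q).
Proof.
move=> mn vM; have M0 : 0 <= M by exact: le_trans (vM 0).
apply: le_trans (ler_norm_sum _ _ _) _.
have : \sum_(m <= i < n) `|q ^+ i.+1 * v i| <= \sum_(m <= i < n) q ^+ i.+1 * M.
  apply: ler_sum => i _; rewrite normrM ger0_norm ?exprn_ge0//.
  by rewrite ler_wpM2l ?exprn_ge0.
move=> /le_trans; apply; rewrite -mulr_suml mulrC -mulrA ler_wpM2l//.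
rewrite ler_pdivlMr//.
have -> : (\sum_(m <= i < n) q ^+ i.+1) * (1 - q) = q ^+ m.+1 - q ^+ n.+1.
  rewrite mulr_suml -(opprB (q ^+ n.+1)) -(telescope_sumr (fun i => q ^+ i.+1))//.
  by rewrite -sumrN; apply: eq_bigr => i _; rewrite !exprS; ring.
by rewrite gerBl exprn_ge0.
Qed.

Lemma cvg_scaled_geometric M : M * q ^+ n.+1 / (1 - q) @[n --> \oo] --> (0 : R).
Proof.
have -> : (fun n => M * q ^+ n.+1 / (1 - q)) = geometric (M * q / (1 - q)) q.
  by apply/funext => n /=; rewrite exprS; ring.
by apply: cvg_geometric; rewrite ger0_norm.
Qed.

Lemma is_cvg_geometric_sum v M : (forall i, `|v i| <= M) ->
  cvgn (series (fun n => q ^+ n.+1 * v n)).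
Proof.
move=> vM; apply: normed_cvg.
apply: (@series_le_cvg _ _ (geometric (M * q) q)) => [n|n|n|].
- exact: normr_ge0.
- rewrite /= !mulr_ge0 ?exprn_ge0//; exact: le_trans (vM 0).
- rewrite /= normrM ger0_norm ?exprn_ge0// exprS.
  rewrite [M * q]mulrC -mulrA -[X in _ <= X]mulrA.
  by rewrite ler_wpM2l// mulrC ler_wpM2r ?exprn_ge0.
- by apply: is_cvg_geometric_series; rewrite ger0_norm.
Qed.

Lemma geometric_sum_norm_le v M : (forall i, `|v i| <= M) ->
  `|limn (series (fun n => q ^+ n.+1 * v n))| <= M * q / (1 - q).
Proof.
move=> vM; have cv := is_cvg_geometric_sum vM.
rewrite -(cvg_lim _ (cvg_norm cv))//.
apply: limr_le; first exact/cvgP/(cvg_norm cv).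
apply: nearW => n; rewrite -[q in M * q]expr1.
exact: geometric_tail_norm_le.
Qed.

(** Tannery's theorem on the diagonal: the number of terms and the stage of approximation grow
    together, so each approximant is a finite sum. *)
Lemma cvg_geometric_dominated (u : nat -> nat -> R) v M :
  (forall n k, `|u n k| <= M) -> (forall n, u n k @[k --> \oo] --> v n) ->
  \sum_(0 <= n < k) q ^+ n.+1 * u n k @[k --> \oo] -->
    limn (series (fun n => q ^+ n.+1 * v n)).
Proof.
move=> uM uv.
have vM n : `|v n| <= M.
  rewrite -(cvg_lim _ (cvg_norm (uv n)))//.
  by apply: limr_le; [exact/cvgP/(cvg_norm (uv n))|exact: nearW].
pose w n k := u n k - v n.
have wM k n : `|w n k| <= M + M by rewrite (le_trans (ler_normB _ _))// lerD.
have w0 n : w n k @[k --> \oo] --> (0 : R).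
  rewrite -(subrr (v n)); apply: cvgB; [exact: uv|exact: cvg_cst].
suff sw0 : \sum_(0 <= n < k) q ^+ n.+1 * w n k @[k --> \oo] --> (0 : R).
  have -> : (fun k => \sum_(0 <= n < k) q ^+ n.+1 * u n k) =
      (fun k => \sum_(0 <= n < k) q ^+ n.+1 * w n k +
                series (fun n => q ^+ n.+1 * v n) k).
    apply/funext => k; rewrite /series/= -big_split/=; apply: eq_bigr => i _.
    by rewrite /w; ring.
  rewrite -[limn _]add0r; apply: (cvgD sw0).
  exact: is_cvg_geometric_sum vM.
apply/cvgrPdist_lt => e e0.
have e2 : 0 < e / 2 by rewrite divr_gt0.
(* This [N] makes all tails from [N] on smaller than [e / 2], uniformly in [k]; the head has a fixed
   number of terms and tends to zero termwise. *)
have /cvgrPdist_lt/(_ _ e2)[N _ /(_ N (leqnn N))] := cvg_scaled_geometric (M + M).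
rewrite /= sub0r normrN => tailN.
have headN : \sum_(0 <= n < N) q ^+ n.+1 * w n k @[k --> \oo] --> (0 : R).
  elim: {tailN} N => [|N IH].
    under eq_fun do rewrite big_nil; exact: cvg_cst.
  under eq_fun do rewrite big_nat_recr//=.
  suff: (\sum_(0 <= i < N) q ^+ i.+1 * w i x + q ^+ N.+1 * w N x
      @[x --> \oo] --> 0 + q ^+ N.+1 * 0) by rewrite mulr0 addr0.
  by apply: cvgD => //; apply: cvgM; [exact: cvg_cst|exact: w0].
have /cvgrPdist_lt/(_ _ e2) := headN.
apply: filter_app; exists N => // k /= Nk.
rewrite !sub0r !normrN => headk.
rewrite (@big_cat_nat _ _ _ N)//= (le_lt_trans (ler_normD _ _))// (splitr e) ltrD//.
apply: le_lt_trans tailN; apply: (le_trans _ (ler_norm _)).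
exact: geometric_tail_norm_le.
Qed.

End GeometricSums.

Lemma geometric_sum_gt0 (R : realType) (q : R) (v : nat -> R) M n :
  0 < q -> q < 1 -> (forall i, 0 <= v i <= M) -> 0 < v n ->
  0 < limn (series (fun i => q ^+ i.+1 * v i)).
Proof.
move=> q0 q1 vM vn; have v0 i : 0 <= v i by case/andP: (vM i).
apply: (@lt_le_trans _ _ (q ^+ n.+1 * v n)); first by rewrite mulr_gt0 ?exprn_gt0.
apply: limr_ge.
  apply: (is_cvg_geometric_sum (ltW q0) q1 (M := M)) => i.
  by rewrite ger0_norm//; case/andP: (vM i).
exists n.+1 => // k /= nk; rewrite /series/=.
rewrite (@big_cat_nat _ _ _ n.+1)//= big_nat_recr//= -addrA addrCA lerDl addr_ge0//.
  by apply: sumr_ge0 => i _; rewrite mulr_ge0 ?exprn_ge0// ltW.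
by apply: sumr_ge0 => i _; rewrite mulr_ge0 ?exprn_ge0// ltW.
Qed.

Lemma continuous_maxr (R : realType) (c : R) : continuous (fun y : R => Num.max y c).
Proof.
move=> y; apply: (@continuous2_cvg _ _ _ _ _ _ id (fun=> c)).
- exact: (@max_continuous _ R (y, c)).
- exact: cvg_id.
- exact: cvg_cst.
Qed.

(** * Baire classes *)

Section BaireClasses.
Context {d : Order.disp_t} {O : bOrderType d} {R : realType}.
Implicit Types (a b : O).

Lemma baire_inv (X : topologicalType) a (f : X -> R) : baire_class a f ->
  (a = \bot%O /\ continuous f) \/
  exists b : nat -> O, exists u : nat -> X -> R,
    [/\ forall n, (b n < a)%O, forall n, baire_class (b n) (u n)
      & forall x, u n x @[n --> \oo] --> f x].
Proof. by case=> [g cg|{}a g b u]; [left|right; exists b, u]. Qed.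

Lemma baire_comp (X Y : topologicalType) (e : Y -> X) a (f : X -> R) :
  continuous e -> baire_class a f -> baire_class a (f \o e).
Proof.
move=> ce; elim=> [{}f cf|{}a {}f b u ba _ IH uf].
  by apply: baire_continuous => x; apply: continuous_comp; [exact: ce|exact: cf].
by apply: baire_limit ba IH _ => x; exact: uf.
Qed.

Section OneSpace.
Context {X : topologicalType}.
Implicit Types (f g : X -> R).

Lemma baire_le a b f : (b <= a)%O -> baire_class b f -> baire_class a f.
Proof.
rewrite le_eqVlt => /orP[/eqP->//|ba] bf.
by apply: (@baire_limit _ _ _ _ _ _ (fun=> b) (fun=> f)) => // x; exact: cvg_cst.
Qed.

Definition baire_below a f := exists2 b, (b < a)%O & baire_class b f.

Lemma baire_belowP a f : (\bot < a)%O -> baire_class a f <->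
  exists u : nat -> X -> R, (forall n, baire_below a (u n)) /\
    forall x, u n x @[n --> \oo] --> f x.
Proof.
move=> a0; split=> [/baire_inv[[a_eq0 _]|[b [u [ba bu uf]]]]|[u [bu uf]]].
- by rewrite a_eq0 ltxx in a0.
- by exists u; split => // n; exists (b n).
have /choice[b {}bu] n : exists b, (b < a)%O /\ baire_class b (u n).
  by have [b] := bu n; exists b.
by apply: (@baire_limit _ _ _ _ _ _ b u) => // n; case: (bu n).
Qed.

Lemma continuous_baire a f : continuous f -> baire_class a f.
Proof.
move=> cf; apply: (@baire_le _ \bot%O); [exact: le0x|exact: baire_continuous].
Qed.

Lemma continuous_baire_below a f : (\bot < a)%O -> continuous f -> baire_below a f.
Proof. by move=> a0 cf; exists \bot%O => //; exact: baire_continuous. Qed.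

(** Joint continuity carries [op] through the limits, and the maximum of two indices below [a] is
    below [a]. Nothing lies below [\bot], so [f] and [g] are both continuous or both limits. *)
Lemma baire_op (op : R -> R -> R) a f g :
  well_ordered O -> continuous (fun p : R * R => op p.1 p.2) ->
  baire_class a f -> baire_class a g -> baire_class a (fun x => op (f x) (g x)).
Proof.
move=> wo cop; elim/(well_founded_ind wo): a => a IH in f g *.
move=> /baire_inv[[-> cf]|[b [u [ba bu uf]]]].
  move=> /baire_inv[[_ cg]|[b [u [ba _ _]]]]; last by have := ba 0; rewrite ltx0.
  apply: baire_continuous => x.
  apply: (@continuous2_cvg _ _ _ _ _ _ f g op).
  - exact: (cop (f x, g x)).
  - exact: cf.
  - exact: cg.
move=> /baire_inv[[a0 _]|[c [v [ca bv vg]]]].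
  by have := ba 0; rewrite a0 ltx0.
apply: (@baire_limit _ _ _ _ _ _ (fun n => Order.max (b n) (c n))
         (fun n x => op (u n x) (v n x))) => [n|n|x].
- by rewrite gt_max ba ca.
- apply: IH; first by rewrite gt_max ba ca.
    by apply: baire_le (bu n); rewrite le_max lexx.
  by apply: baire_le (bv n); rewrite le_max lexx orbT.
apply: (@continuous2_cvg _ _ _ _ _ _ (u ^~ x) (v ^~ x) op).
- exact: (cop (f x, g x)).
- exact: uf.
- exact: vg.
Qed.
End OneSpace.
End BaireClasses.

Section BaireOperations.
Context {d : Order.disp_t} {O : bOrderType d} {R : realType}.
Context {X : topologicalType}.
Hypothesis wo : well_ordered O.
Implicit Types (a b : O) (f g : X -> R).

Lemma baire_map (phi : R -> R) a f :
  continuous phi -> baire_class a f -> baire_class a (phi \o f).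
Proof.
move=> cphi bf; apply: (@baire_op _ _ _ _ (fun y _ => phi y) _ _ _ wo _ bf bf).
by move=> p; apply: (@continuous_comp _ _ _ fst phi); [exact: cvg_fst|exact: cphi].
Qed.

Lemma baireD a f g :
  baire_class a f -> baire_class a g -> baire_class a (fun x => f x + g x).
Proof. by apply: baire_op => //; exact: add_continuous. Qed.

Lemma baireM a f g :
  baire_class a f -> baire_class a g -> baire_class a (fun x => f x * g x).
Proof. by apply: baire_op => //; exact: mul_continuous. Qed.

Lemma baire_cst a (r : R) : baire_class a (fun _ : X => r).
Proof. by apply: continuous_baire => x; exact: cvg_cst. Qed.

Lemma baireB a f g :
  baire_class a f -> baire_class a g -> baire_class a (fun x => f x - g x).
Proof.
move=> bf bg; apply: baireD => //.
by apply: (@baire_map -%R) => //; exact: opp_continuous.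
Qed.

Lemma baire_below_op (op : R -> R -> R) a f g :
  (forall b f g, baire_class b f -> baire_class b g ->
    baire_class b (fun x : X => op (f x) (g x))) ->
  baire_below a f -> baire_below a g -> baire_below a (fun x => op (f x) (g x)).
Proof.
move=> bop [b ba bf] [c ca cg]; exists (Order.max b c); first by rewrite gt_max ba.
by apply: bop; [apply: baire_le bf|apply: baire_le cg]; rewrite le_max lexx ?orbT.
Qed.

Lemma baire_below_map (phi : R -> R) a f :
  continuous phi -> baire_below a f -> baire_below a (phi \o f).
Proof. by move=> cphi [b ba bf]; exists b => //; exact: baire_map. Qed.

Lemma baire_below_sum a (f : nat -> X -> R) n : (\bot < a)%O ->
  (forall i, baire_below a (f i)) ->
  baire_below a (fun x => \sum_(0 <= i < n) f i x).
Proof.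
move=> a0 bf; elim: n => [|n IH].
  under eq_fun do rewrite big_nil.
  by apply: continuous_baire_below => // x; exact: cvg_cst.
under eq_fun do rewrite big_nat_recr//=.
by apply: baire_below_op IH _ => //; exact: baireD.
Qed.

Lemma baire_below_prod a (f : nat -> X -> R) n : (\bot < a)%O ->
  (forall i, baire_below a (f i)) ->
  baire_below a (fun x => \prod_(0 <= i < n) f i x).
Proof.
move=> a0 bf; elim: n => [|n IH].
  under eq_fun do rewrite big_nil.
  by apply: continuous_baire_below => // x; exact: cvg_cst.
under eq_fun do rewrite big_nat_recr//=.
by apply: baire_below_op IH _ => //; exact: baireM.
Qed.

(** Clipping to the interval from [- M] to [M] is continuous and fixes the values of [f], so the
    approximants may be clipped. *)
Lemma baire_below_bounded a f M : (\bot < a)%O -> baire_class a f ->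
  (forall x, `|f x| <= M) -> exists u : nat -> X -> R,
    [/\ forall n, baire_below a (u n), forall n x, `|u n x| <= M
      & forall x, u n x @[n --> \oo] --> f x].
Proof.
move=> a0 /(baire_belowP _ a0)[u [bu uf]] fM.
pose clip (y : R) := Num.max (- M) (Num.min y M).
have cclip : continuous clip.
  move=> y; apply: (@continuous2_cvg _ _ _ _ _ _ (fun=> - M) (Num.min ^~ M)).
  - exact: (@max_continuous _ R (- M, Num.min y M)).
  - exact: cvg_cst.
  - apply: (@continuous2_cvg _ _ _ _ _ _ id (fun=> M)).
    + exact: (@min_continuous _ R (y, M)).
    + exact: cvg_id.
    + exact: cvg_cst.
exists (fun n => clip \o u n); split => [n|n x|x].
- exact: baire_below_map.
- have M0 : 0 <= M by exact: le_trans (fM x).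
  rewrite /= ler_norml /clip le_max lexx/= ge_max ge_min lexx orbT andbT.
  by rewrite ge0_cp.
- have -> : f x = clip (f x).
    have /andP[Mf fM'] : - M <= f x <= M by rewrite -ler_norml.
    by rewrite /clip (min_idPl fM') (max_idPr Mf).
  exact: (continuous_cvg _ (cclip (f x)) (uf x)).
Qed.

(** The [k]-th approximant is the [k]-th partial sum with every [f n] replaced by its [k]-th clipped
    approximant; the common bound [M] gives domination. *)
Lemma baire_geometric_sum a (q : R) (f : nat -> X -> R) M : (\bot < a)%O ->
  0 <= q -> q < 1 -> (forall n, baire_class a (f n)) ->
  (forall n x, `|f n x| <= M) ->
  baire_class a (fun x => limn (series (fun n => q ^+ n.+1 * f n x))).
Proof.
move=> a0 q0 q1 bf fM.
have /choice[u uf] n := baire_below_bounded a0 (bf n) (fM n).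
apply/baire_belowP => //.
exists (fun k x => \sum_(0 <= n < k) q ^+ n.+1 * u n k x); split => [k|x].
  apply: baire_below_sum => // i; have [bu _ _] := uf i.
  by apply: (@baire_below_map ( *%R (q ^+ i.+1))) => //; exact: mulrl_continuous.
apply: (cvg_geometric_dominated q0 q1 (M := M)) => [n k|n].
  by have [_ + _] := uf n; exact.
by have [_ _] := uf n; exact.
Qed.

Lemma baire_div a f g : (\bot < a)%O -> baire_class a f -> baire_class a g ->
  (forall x, 0 < g x) -> baire_class a (fun x => f x / g x).
Proof.
move=> a0 /(baire_belowP _ a0)[u [bu uf]] /(baire_belowP _ a0)[v [bv vg]] g0.
apply/baire_belowP => //.
(* The approximations of [g] need not be positive, so their denominators are
   bounded below by [1 / (n + 1)]. *)
exists (fun n x => u n x / Num.max (v n x) n.+1%:R^-1); split => [n|x].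
  apply: (@baire_below_op *%R) (bu n) _; first exact: baireM.
  apply: (@baire_below_map (fun y => (Num.max y n.+1%:R^-1)^-1)) => // y.
  apply: cvgV.
    by rewrite gt_eqF// lt_max invr_gt0 ltr0n orbT.
  exact: continuous_maxr.
apply: cvgM; first exact: uf.
(* The lower bounds tend to [0], and the maximum of [g x] and [0] is [g x]. *)
suff : Num.max (v n x) n.+1%:R^-1 @[n --> \oo] --> Num.max (g x) 0.
  rewrite (max_idPl (ltW (g0 x))); apply: cvgV.
  by rewrite gt_eqF.
apply: continuous2_cvg.
- exact: (@max_continuous _ R (g x, 0)).
- exact: vg.
- exact: cvg_harmonic.
Qed.

(** The partial products of the [phi i] are [1] on [F], and off [F] they vanish from some stage
    on. *)
Lemma baire_indic_of_zeros a (F : set X) (phi : nat -> X -> R) :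
  (\bot < a)%O -> (forall n, baire_below a (phi n)) ->
  (forall n x, F x -> phi n x = 1) ->
  (forall x, ~ F x -> exists n, phi n x = 0) ->
  baire_class a (\1_F : X -> R).
Proof.
move=> a0 bphi phi1 phi0; apply/baire_belowP => //.
exists (fun k x => \prod_(0 <= i < k) phi i x); split => [k|x].
  exact: baire_below_prod.
rewrite indicE; have [Fx|Fx] := pselect (F x).
  rewrite mem_set//; under eq_fun do under eq_bigr do rewrite phi1//.
  by under eq_fun do rewrite big1//; exact: cvg_cst.
rewrite memNset//; have [n phin] := phi0 x Fx.
apply: cvg_near_cst; exists n.+1 => // k /= nk.
by rewrite (big_rem n) ?mem_index_iota//= phin mul0r.
Qed.

End BaireOperations.

(** * Borel sets and Baire functions: indicators and level sets *)

Section BaireBorel.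
Context {d : Order.disp_t} {O : bOrderType d} {R : realType}.
Context {T : topologicalType}.
Hypothesis wo : well_ordered O.
Hypothesis pnT : perfectly_normal_space T.
Implicit Types (a b s : O) (F H : set T).

(** The factors for [baire_indic_of_zeros] are Urysohn functions when [F] is closed. Otherwise they
    are the indicators of the [G n], of lower class by induction applied to their complements. *)
Lemma pi0_baire_indic a F : pi0 a F -> baire_class a (\1_F : T -> R).
Proof.
elim/(well_founded_ind wo): a => a IH in F *.
move=> pF; have a0 := pi0_gt0 pF; case/pi0_inv: (pF) => [[_ cF]|[b [G [ba bG FG]]]].
  have [U oU FU] := pnT.2 _ cF.
  have /choice[phi phiP] n : exists phi : T -> R, [/\ continuous phi,
      forall x, F x -> phi x = 1 & forall x, ~ U n x -> phi x = 0].
    have UF0 : ~` U n `&` F = set0.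
      by rewrite -subset0 => x [nUx]; rewrite FU => /(_ n I).
    have [phi [cphi phi0 phi1 _]] := urysohn_ext_itv pnT.1
      (open_closedC (oU n)) cF UF0 (@ltr01 R).
    exists phi; split => // x Fx; first by apply: phi1; exists x.
    by apply: phi0; exists x.
  apply: (@baire_indic_of_zeros _ _ _ _ wo _ _ phi) => // [n|n x Fx|x].
  - by apply: continuous_baire_below => //; have [] := phiP n.
  - by have [_ + _] := phiP n; exact.
  - rewrite FU => /existsNP[n /not_implyP[_ Ux]]; exists n.
    by have [_ _] := phiP n; exact.
apply: (@baire_indic_of_zeros _ _ _ _ wo _ _
  (fun n x => 1 - \1_(~` G n) x)) => // [n|n x|x].
- exists (b n) => //; apply: baireB => //; first exact: baire_cst.
  by apply: IH => //; exact: pi0_setC.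
- by rewrite FG => /(_ n I) Gx; rewrite indicE memNset ?subr0//; exact.
- rewrite FG => /existsNP[n /not_implyP[_ Gx]]; exists n.
  by rewrite indicE mem_set ?subrr.
Qed.

(* [\1_H] is [p / (p + r)] for functions [p, r >= 0] of class [a] with
   [0 < p] exactly on [H] and [0 < r] exactly off [H]. *)
Lemma delta0_baire_indic a s H : (\bot < a)%O -> is_succ a s -> delta0 s H ->
  baire_class a (\1_H : T -> R).
Proof.
move=> a0 as_ [pH sH].
have lt_as : (a < s)%O by rewrite as_.
have s1 : ~ is_one s by move=> s1; move: a0; rewrite (is_oneP s1 lt_as) ltxx.
have half0 : 0 < (2^-1 : R) by lra.
have half1 : (2^-1 : R) < 1 by lra.
have wsum K : sigma0 s K -> exists p : T -> R,
    [/\ baire_class a p, forall x, K x -> 0 < p x & forall x, ~ K x -> p x = 0].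
  move=> /(sigma0_bigcupP s1)[F [bF KF]].
  have pF n : pi0 a (F n).
    (* An index below the successor [s] is at most [a]. *)
    by have [b bs bFn] := bF n; apply: pi0_le bFn => //; rewrite -as_.
  have F1 n x : 0 <= (\1_(F n) x : R) <= 1.
    by rewrite indicE; case: (x \in _) => //=; lra.
  exists (fun x => limn (series (fun n => (2^-1 : R) ^+ n.+1 * \1_(F n) x))); split.
  - apply: (@baire_geometric_sum _ _ _ _ wo _ 2^-1 (fun n => \1_(F n)) 1) => //.
    + by move=> n; exact: pi0_baire_indic.
    + by move=> n x; have /andP[F0 ?] := F1 n x; rewrite ger0_norm.
  - rewrite KF => x [n _ Fx].
    apply: (@geometric_sum_gt0 _ _ _ 1 n) => //.
    by rewrite indicE mem_set//.
  - rewrite KF => x Kx.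
    apply/eqP; rewrite -normr_le0.
    (* Off [K] all the terms vanish, so the norm bound applies with [M = 0]. *)
    have := @geometric_sum_norm_le R 2^-1 (ltW half0) half1 (fun n => \1_(F n) x) 0.
    rewrite !mul0r; apply => n.
    by rewrite indicE memNset ?normr0// => Fx; apply: Kx; exists n.
have [p [bp p0 p1]] := wsum _ sH.
have [r [br r0 r1]] := wsum _ (sigma0_setC wo pH).
have -> : \1_H = (fun x => p x / (p x + r x)) :> (T -> R).
  apply/funext => x; rewrite indicE; have [Hx|Hx] := pselect (H x).
    by rewrite mem_set// (r1 x) ?addr0 ?divff ?gt_eqF ?p0//; exact.
  by rewrite memNset// p1// mul0r.
apply: baire_div => //; first exact: baireD.
move=> x; have [Hx|Hx] := pselect (H x).
  by rewrite (r1 x) ?addr0 ?p0//; exact.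
by rewrite p1// add0r r0.
Qed.

(* [e] induces the topology of [X]: it is the inclusion of a subspace or the
   identity.  The level set is that of the upper limit of the [u n], whence
   the intersection of unions. *)
Lemma baire_superlevel (X : topologicalType) (e : X -> T) a s (f : X -> R) t :
  (forall C : set X, closed C -> exists2 D : set T, closed D & C = e @^-1` D) ->
  (a < s)%O -> baire_class a f ->
  exists2 P : set T, pi0 s P & e @^-1` P = [set x | t <= f x].
Proof.
move=> eC; elim/(well_founded_ind wo): a => a IH in s f t *.
move=> as_ bf; have s0 : (\bot < s)%O := le_lt_trans (le0x _) as_.
case/baire_inv: (bf) => [[_ cf]|[b [u [ba bu uf]]]].
  have [|P cP ->] := eC [set x | t <= f x]; last by exists P => //; exact: closed_pi0.
  by apply: (closed_comp (f := f) _ (@closed_ge _ t)) => x _; exact: cf.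
(* The induction hypothesis is applied to [- u n] with [a] in the role of [s], which turns sublevel
   sets into superlevel sets and leaves one level free for the final intersection. *)
have /choice[P PP] (nm : nat * nat) : exists P : set T,
    pi0 a P /\ e @^-1` P = [set x | u nm.1 x <= t - nm.2.+1%:R^-1].
  have [|P pP eP] := IH _ (ba nm.1) a (fun x => - u nm.1 x)
    (- (t - nm.2.+1%:R^-1)) (ba nm.1).
    by apply: (@baire_map _ _ _ _ wo -%R) => //; exact: opp_continuous.
  by exists P; split => //; rewrite eP; apply/seteqP; split=> x /=; rewrite lerN2.
(* One [m] serves both as the tolerance [1 / (m + 1)] and as the stage from which an index is
   sought. *)
exists (\bigcap_m \bigcup_k ~` P ((m + k)%N, m)).
  apply: (@pi0_bigcap _ _ _ _ (fun=> a)) => // m.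
  apply: sigma0_bigcup_countable => // k.
  by apply: sigma0_setC => //; have [] := PP ((m + k)%N, m).
apply/seteqP; split=> x /= Hx.
  suff t_le (eps : R) : 0 < eps -> t <= f x + eps by apply/ler_addgt0Pr.
  move=> eps0; have eps2 : 0 < eps / 2 by rewrite divr_gt0.
  have /cvgrPdist_lt/(_ _ eps2)[N _ HN] := uf x.
  have /cvgrPdist_lt/(_ _ eps2)[N' _ HN'] := @cvg_harmonic R.
  (* Taking [m] as this maximum makes both [1 / (m + 1)] and the distance from [f x] to later
     [u n x] smaller than [eps / 2]. *)
  have [k _ nPx] := Hx (maxn N N') I.
  have {}nPx : t - (maxn N N').+1%:R^-1 < u (maxn N N' + k)%N x.
    rewrite ltNge; apply/negP => ux; apply: nPx.
    by have [_ /seteqP[_]] := PP ((maxn N N' + k)%N, maxn N N'); apply.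

  have := HN (maxn N N' + k)%N (leq_trans (leq_maxl N N') (leq_addr _ _)).
  have := HN' (maxn N N') (leq_maxr _ _); rewrite /= sub0r normrN.
  move=> /ltr_normlW harm; rewrite ltr_distlC => /andP[_ uf_lt].
  rewrite (splitr eps) addrA -[t](subrK (maxn N N').+1%:R^-1).
  by apply/ltW/ltrD; [exact: lt_trans nPx uf_lt|exact: harm].
move=> m _; have m0 : 0 < m.+1%:R^-1 :> R by rewrite invr_gt0.
have /cvgrPdist_lt/(_ _ m0)[N _ /(_ (m + N)%N (leq_addl _ _))] := uf x.
rewrite /= => ux; exists N => // Px.
have [_ /seteqP[/(_ x Px) /= + _]] := PP ((m + N)%N, m).
rewrite lerBrDr addrC => uht; move: ux => /ltr_normlW; rewrite ltrBlDr => fuh.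
by have := lt_le_trans fuh (le_trans uht Hx); rewrite ltxx.
Qed.

End BaireBorel.

(** * Extension *)

Lemma closed_subspaceP (T : topologicalType) (A : set T) (C : set A) :
  closed C -> exists2 D : set T, closed D & C = (\val : A -> T) @^-1` D.
Proof.
move=> /closed_openC[V oV VC]; exists (~` V); first exact: open_closedC.
by apply: setC_inj; rewrite preimage_setC setCK; exact: esym VC.
Qed.

Lemma continuous_set_val (T : topologicalType) (A : set T) :
  continuous (\val : A -> T).
Proof. exact: initial_continuous. Qed.

Section Extension.
Context {d : Order.disp_t} {O : bOrderType d} {R : realType}.
Context {T : topologicalType}.
Hypothesis wo : well_ordered O.
Hypothesis pnT : perfectly_normal_space T.
Context (a s : O) (A : set T).
Hypothesis a0 : (\bot < a)%O.
Hypothesis as_ : is_succ a s.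
Hypothesis pA : pi0 s A.

Let lt_as : (a < s)%O. Proof. by rewrite as_. Qed.

(** The level sets are traces of sets [P] and [Q] that may meet outside [A]. Intersecting them with
    [A] makes them disjoint and keeps them in [pi0 s], because [A] is of that class. *)
Lemma baire_level_separation (f : A -> R) (l r : R) : l < r -> baire_class a f ->
  exists2 D : set T, delta0 s D & forall x : A,
    (f x <= l -> D (\val x)) /\ (r <= f x -> ~ D (\val x)).
Proof.
move=> lr bf.
have [Q pQ QE] := baire_superlevel wo pnT r (@closed_subspaceP T A) lt_as bf.
have bNf : baire_class a (fun x => - f x).
  by apply: (@baire_map _ _ _ _ wo -%R) => //; exact: opp_continuous.
have [P pP PE] := baire_superlevel wo pnT (- l) (@closed_subspaceP T A) lt_as bNf.
have PAE (x : A) : P (\val x) = (f x <= l) :> Prop.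
  by have := congr1 (fun S => S x) PE; rewrite /= lerN2.
have QAE (x : A) : Q (\val x) = (r <= f x) :> Prop.
  exact: (congr1 (fun S => S x) QE).
have PQ0 : (A `&` P) `&` (A `&` Q) = set0.
  rewrite -subset0 => x [[Ax Px] [_ Qx]].
  have := PAE (SigSub (mem_set Ax)); rewrite /= => PxE.
  have := QAE (SigSub (mem_set Ax)); rewrite /= => QxE.
  move: Px Qx; rewrite PxE QxE => fl rf.
  by have := lt_le_trans lr (le_trans rf fl); rewrite ltxx.
have [D [dD PD QD]] := pi0_separation wo pnT a0 lt_as (pi0_setI wo pnT pA pP)
  (pi0_setI wo pnT pA pQ) PQ0.
exists D => // x; have Ax : A (\val x) by exact: set_valP.
by split=> fx; [apply: PD|apply: QD]; split => //; rewrite ?PAE ?QAE.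
Qed.

(** The conditions on [r] stand under the existential so that one choice function covers all pairs
    of [n] and [r]; [set0] is the default. *)
Lemma residual_step (c : R) n (r : A -> R) : 0 <= c ->
  exists H : set T, baire_class a r /\ (forall x, `|r x| <= c * (2 / 3) ^+ n) ->
    delta0 s H /\ forall x : A,
      `|r x - c * ((2 / 3) ^+ n.+1 * (1 / 2 - \1_H (\val x)))| <=
        c * (2 / 3) ^+ n.+1.
Proof.
move=> c0; have [[br rM]|no] := pselect (baire_class a r /\
  (forall x, `|r x| <= c * (2 / 3) ^+ n)); last by exists set0.
pose M := c * (2 / 3) ^+ n.
(* Any positive threshold will do when [c = 0], and [M / 3] would be zero. *)
pose t := if c == 0 then 1 else M / 3.
have t0 : 0 < t.
  rewrite /t; case: ifPn => // cn0.
  by rewrite divr_gt0// mulr_gt0 ?exprn_gt0 ?lt0r ?cn0//; lra.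
have [|H dH Hsep] := @baire_level_separation r (- t) t _ br; first by lra.
exists H => _; split => // x.
have -> : c * ((2 / 3) ^+ n.+1 * (1 / 2 - \1_H (\val x))) =
    M * (2 / 3) * (1 / 2 - \1_H (\val x)) by rewrite exprS /M; ring.
have -> : c * (2 / 3) ^+ n.+1 = M * (2 / 3) by rewrite exprS /M; ring.
have := rM x; rewrite -/M !ler_norml => /andP[Mr rM'].
have [Hl Hr] := Hsep x.
have tM : t = M / 3 \/ M = 0.
  by rewrite /t /M; case: eqVneq => [->|]; [right; rewrite mul0r|left].
(* On [H] the residual lies between [- M] and [M / 3] and is raised by [M / 3]; off [H] it lies
   between [- M / 3] and [M] and is lowered by [M / 3]. *)
rewrite indicE; have [Hx|Hx] := pselect (H (\val x)).
  rewrite mem_set//= mulr1n.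
  have rt : r x < t by rewrite ltNge; apply/negP => /Hr.
  by apply/andP; split; case: tM => tM; move: rt Mr rM'; rewrite tM; lra.
rewrite memNset//= mulr0n.
have rt : - t < r x by rewrite ltNge; apply/negP => /Hl.
by apply/andP; split; case: tM => tM; move: rt Mr rM'; rewrite tM; lra.
Qed.

Lemma bounded_extension (c : R) (f : A -> R) : 0 <= c -> baire_class a f ->
  (forall x, `|f x| <= c) -> exists H : nat -> set T,
    [/\ forall n, delta0 s (H n), baire_class a (geometric_step_sum c H),
        forall x : A, geometric_step_sum c H (\val x) = f x
      & forall x, `|geometric_step_sum c H x| <= c].
Proof.
move=> c0 bf fc.
have /choice[Hs HsP] : forall p : nat * (A -> R), exists H : set T,
    baire_class a p.2 /\ (forall x, `|p.2 x| <= c * (2 / 3) ^+ p.1) ->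
    delta0 s H /\ forall x : A,
      `|p.2 x - c * ((2 / 3) ^+ p.1.+1 * (1 / 2 - \1_H (\val x)))| <=
        c * (2 / 3) ^+ p.1.+1.
  by move=> p; exact: residual_step.
(* Each set depends on the current residual, and the next residual on that set; the choice function
   [Hs] makes this a plain recursion. *)
pose fix r n : A -> R := if n is m.+1 then
  fun x => r m x - c * ((2 / 3) ^+ m.+1 * (1 / 2 - \1_(Hs (m, r m)) (\val x)))
  else f.
pose H n := Hs (n, r n).
have rP n : baire_class a (r n) /\ forall x, `|r n x| <= c * (2 / 3) ^+ n.
  elim: n => [|n [br rM]]; first by split => // x; rewrite expr0 mulr1.
  have [dH rH] := HsP (n, r n) (conj br rM); split => //=.
  apply: baireB => //.
  apply: (@baire_map _ _ _ _ wo (fun y => c * ((2 / 3) ^+ n.+1 * (1 / 2 - y))) _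
    (fun x : A => \1_(Hs (n, r n)) (\val x))).
    move=> y; apply: cvgM; first exact: cvg_cst.
    apply: cvgM; first exact: cvg_cst.
    by apply: cvgB; [exact: cvg_cst|exact: cvg_id].
  apply: (@baire_comp _ _ _ _ _ (\val : A -> T) _ \1_(Hs (n, r n))).
    exact: continuous_set_val.
  exact: delta0_baire_indic as_ dH.
have dH n : delta0 s (H n) by have [] := HsP (n, r n) (rP n).
have q0 : 0 <= (2 / 3 : R) by lra.
have q1 : (2 / 3 : R) < 1 by lra.
have vM n x : `|1 / 2 - \1_(H n) x| <= 2^-1 :> R.
  rewrite indicE ler_norml; case: (x \in H n) => /=; lra.
exists H; split => // [|x|x].
- apply: (@baire_map _ _ _ _ wo ( *%R c)); first exact: mulrl_continuous.
  apply: (@baire_geometric_sum _ _ _ _ wo _ (2 / 3)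
    (fun n x => 1 / 2 - \1_(H n) x) 2^-1) => // n.
  apply: baireB => //; first exact: baire_cst.
  exact: delta0_baire_indic (dH n).
- rewrite /geometric_step_sum.
  set S := series _.
  (* The residuals are [f] minus the partial sums and tend to zero, so the series has sum [f] on
     [A]. *)
  have rE n : r n x = f x - c * S n.
    elim: n => [|n IH]; first by rewrite /S /series/= big_geq// mulr0 subr0.
    by rewrite /= IH /S /series/= big_nat_recr//= mulrDr -/(H n); ring.
  have r0 : r n x @[n --> \oo] --> (0 : R).
    apply/norm_cvg0P.
    apply: (@squeeze_cvgr _ _ _ _ (fun=> 0) (geometric c (2 / 3))).
    + by apply: nearW => n; rewrite normr_ge0/=; have [_] := rP n; exact.
    + exact: cvg_cst.
    + by apply: cvg_geometric; rewrite ger0_norm.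
  have cS : cvgn S by apply: (is_cvg_geometric_sum q0 q1) => n; exact: vM.
  have : f x - c * S n @[n --> \oo] --> f x - c * limn S.
    by apply: cvgB; [exact: cvg_cst|apply: cvgM; [exact: cvg_cst|exact: cS]].
  have -> : (fun n => f x - c * S n) = (fun n => r n x).
    by apply/funext => n; rewrite rE.
  move=> /(cvg_unique _ r0) => /(_ (@norm_hausdorff _ _))/eqP.
  by rewrite eq_sym subr_eq0 => /eqP.
- rewrite /geometric_step_sum normrM ger0_norm// ler_piMr//.
  (* The terms are bounded by [1 / 2] before weighting, and
     [(1 / 2) * (2 / 3) / (1 - 2 / 3) = 1]. *)
  apply: le_trans (geometric_sum_norm_le q0 q1 (fun n => vM n x)) _.
  by rewrite ler_pdivrMr ?subr_gt0//; lra.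
Qed.

Lemma unbounded_extension (f : A -> R) : baire_class a f ->
  exists2 g : T -> R, baire_class a g & forall x : A, g (\val x) = f x.
Proof.
move=> bf; pose h0 x := f x / (1 + `|f x|).
have f1 x : 0 < 1 + `|f x| by rewrite ltr_wpDr.
have h01 x : `|h0 x| < 1.
  rewrite /h0 normrM normfV (ger0_norm (ltW (f1 x))) ltr_pdivrMr// mul1r.
  by rewrite ltrDr.
have bh0 : baire_class a h0.
  apply: baire_div => //; apply: (@baire_map _ _ _ _ wo (fun y => 1 + `|y|)) => //.
  by move=> y; apply: cvgD; [exact: cvg_cst|exact: norm_continuous].
have [H [_ bh hE h1]] := bounded_extension ler01 bh0 (fun x => ltW (h01 x)).
move: (geometric_step_sum 1 H) bh hE h1 => h bh hE h1 {H}.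
have bnh : baire_class a (fun x => `|h x|).
  by apply: (@baire_map _ _ _ _ wo (@Num.norm R R)) => //; exact: norm_continuous.
have idC (C : set T) : closed C -> exists2 D : set T, closed D & C = id @^-1` D.
  by exists C.
(* Off [A] the extension [h] may reach [1] in absolute value, where [y / (1 - |y|)] breaks down; [P]
   collects these points. *)
have [P pP PE] := baire_superlevel wo pnT 1 idC lt_as bnh.
have PP x : P x = (1 <= `|h x|) :> Prop := congr1 (fun S => S x) PE.
have AP0 : A `&` P = set0.
  rewrite -subset0 => x [Ax]; rewrite PP.
  have := hE (SigSub (mem_set Ax)); rewrite /= => ->.
  by rewrite leNgt h01.
have [D [dD AD PD]] := pi0_separation wo pnT a0 lt_as pA pP AP0.
pose k x := h x * \1_D x.
have k1 x : `|k x| < 1.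
  rewrite /k indicE; have [Dx|Dx] := pselect (D x).
    rewrite mem_set// mulr1 ltNge; apply/negP => h1x.
    by apply: (PD x) => //; rewrite PP.
  by rewrite memNset// mulr0 normr0.
have bk : baire_class a k.
  by apply: baireM => //; exact: delta0_baire_indic dD.
exists (fun x => k x / (1 - `|k x|)).
  apply: baire_div => //; last by move=> x; rewrite subr_gt0.
  apply: (@baire_map _ _ _ _ wo (fun y => 1 - `|y|)) => //.
  by move=> y; apply: cvgB; [exact: cvg_cst|exact: norm_continuous].
move=> x; have -> : k (\val x) = h0 x.
  by rewrite /k hE indicE mem_set ?mulr1//; apply/AD/set_valP.
(* Here [1 - |h0| = 1 / (1 + |f|)], so the quotient recovers [f]. *)
have := f1 x; rewrite /h0 normrM normfV (ger0_norm (ltW (f1 x))) => fx.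
have -> : 1 - `|f x| / (1 + `|f x|) = (1 + `|f x|)^-1.
  by field; rewrite gt_eqF.
by rewrite invrK divfK// gt_eqF.
Qed.

End Extension.

(** * Supremum norms and the extension theorem *)

Lemma sup_norm_ub (R : realType) (X : Type) (f : X -> R) x :
  (`|f x|%:E <= sup_norm f)%E.
Proof. by apply: ereal_sup_ubound; exists x. Qed.

Lemma sup_norm_extension_ge (R : realType) (X Y : Type) (e : Y -> X)
    (f : Y -> R) (g : X -> R) :
  (forall x, g (e x) = f x) -> (sup_norm f <= sup_norm g)%E.
Proof.
by move=> gf; apply: ereal_sup_le => _ [x _ <-]; exists (e x) => //; rewrite gf.
Qed.

Theorem theorem4p2 (R : realType) (Omega : topologicalType)
    (d : Order.disp_t) (O : bOrderType d) (alpha alpha1 : O)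
    (A : set Omega) (f : A -> R) :
  perfectly_normal_space Omega ->
  well_ordered O ->
  (\bot < alpha)%O ->
  countable [set b : O | (b < alpha)%O] ->
  is_succ alpha alpha1 ->
  pi0 alpha1 A ->
  A !=set0 ->
  baire_class alpha f ->
  (exists g : Omega -> R,
    [/\ baire_class alpha g,
        forall x : A, g (\val x) = f x
      & sup_norm f = sup_norm g]) /\
  (forall c : R, sup_norm f = c%:E ->
    exists H : nat -> set Omega,
      (forall n, delta0 alpha1 (H n)) /\
      let g := geometric_step_sum c H in
      [/\ baire_class alpha g,
          forall x : A, g (\val x) = f x
        & sup_norm g = c%:E]).
Proof.
move=> pnT wo a0 _ as_ pA [x0 Ax0] bf.
pose y0 : A := SigSub (mem_set Ax0).
have bounded_case c : sup_norm f = c%:E -> exists H : nat -> set Omega,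
    (forall n, delta0 alpha1 (H n)) /\ let g := geometric_step_sum c H in
    [/\ baire_class alpha g, forall x : A, g (\val x) = f x & sup_norm g = c%:E].
  move=> fc.
  have fM x : `|f x| <= c by rewrite -lee_fin -fc sup_norm_ub.
  have c0 : 0 <= c by exact: le_trans (fM y0).
  have [H [dH bg gf gc]] := bounded_extension wo pnT a0 as_ pA c0 bf fM.
  exists H; split => //; split => //; apply/eqP; rewrite eq_le; apply/andP; split.
    by apply: ge_ereal_sup => _ [x _ <-]; rewrite lee_fin.
  by rewrite -fc; exact: sup_norm_extension_ge gf.
split => //; case fE : (sup_norm f) => [c| |].
- by have [H [_ [bg gf gc]]] := bounded_case c fE; exists (geometric_step_sum c H).
(* An extension has at least the norm of [f], so here every extension has infinite norm. *)
- have [g bg gf] := unbounded_extension wo pnT a0 as_ pA bf.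
  exists g; split => //; apply/esym/eqP; rewrite -leye_eq -fE.
  exact: sup_norm_extension_ge gf.
(* The value [-oo] is excluded by the point [y0] of [A]. *)
- by have := sup_norm_ub f y0; rewrite fE leeNy_eq.
Qed.
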